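(* Let $\textsc{Leq}=\{L_m : m\in\mathbb N\cup\{\infty\}\}$ be the class of languages of Python-like programs described in the context. Then $\textsc{Leq}$ is not $\aleph$-emulatable.
   Context: Setting. $\Sigma$ is a finite alphabet (containing the characters needed to write Python programs), $\lambda$ is the empty string, and a pair $\kappa=\langle l,r\rangle\in(\Sigma^\star)^2$ is called a context. $Y$ is a countable set of referents containing a special null symbol $\emptyset\in Y$. Language with semantics. A language $L$ is a set of strings $L\subseteq\Sigma^\star$ together with a denotation function assigning to each $e\in\Sigma^\star$ and each context $\kappa=\langle l,r\rangle$ a value $[\![e\mid\kappa]\!]_L=[\![e\mid l,r]\!]_L\in Y$ (the value of $e$ when it occurs in the larger string $ler\in L$). One has $[\![e\mid\kappa]\!]_L=\emptyset$ iff $e$ is not a valid expression in the context $\kappa$. The support of a context is $\mathrm{supp}_L(\kappa)=\{e\in\Sigma^\star : [\![e\mid\kappa]\!]_L\neq\emptyset\}$. Assertion oracle. $\aleph_L(e,e'\mid\kappa)=1$ if $[\![e\mid\kappa]\!]_L=[\![e'\mid\kappa]\!]_L$, and $0$ otherwise, for $e,e'\in\Sigma^\star$, $\kappa\in(\Sigma^\star)^2$. Oracle machines. For an oracle Turing machine $\mu$, $\mu_L(e)$ denotes the output of $\mu$ on input $e$ when its oracle is $\aleph_L$ (the machine may query $\aleph_L$ on any triple $(e_1,e_2,\kappa)$). $\aleph$-emulation. A class $\mathcal L$ of languages over $\Sigma$ is $\aleph$-emulatable if there exist a single oracle Turing machine $\mu$ and a single standard Turing machine $\delta$ (with no oracle)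 such that for all $L\in\mathcal L$, all $\kappa\in(\Sigma^\star)^2$ and all $e,e'\in\mathrm{supp}_L(\kappa)$, the computations $\mu_L(e)$, $\mu_L(e')$ and $\delta(\mu_L(e),\mu_L(e')\mid\kappa)$ halt and $$[\![e\mid\kappa]\!]_L=[\![e'\mid\kappa]\!]_L\iff \delta\big(\mu_L(e),\mu_L(e')\mid\kappa\big),$$ where the right-hand side means that $\delta$ accepts. The class $\textsc{Leq}$. For $m\in\mathbb N\cup\{\infty\}$, the strings of $L_m$ are the programs obtained from the following two templates by letting $n$ range over $\mathbb N$, written as a decimal numeral (so the set of strings does not depend on $m$): Template 1 (three lines): ''def leq() -> bool:'' / '' return $n$ < M'' / ''print(leq())'' Template 2 (three lines): ''def leq() -> bool:'' / '' return $n$ < M'' / ''print(True)'' Semantics of $L_m$: the expression M has $[\![\texttt{M}\mid\kappa]\!]_{L_m}=m$. For any other $e$ with $ler\in L_m$ that is a well-formed Python 3.8 expression there, $[\![e\mid l,r]\!]_{L_m}$ is the value assigned to $e$ by the Python interpreter in the context $\langle l,r\rangle$ (with M evaluating to $m$). For strings that are not valid Python expressions, $[\![e\mid l,r]\!]_{L_m}=\emptyset$. In particular, in the context $\kappa_n=\langle l_n,r\rangle$, where $l_n$ is the program text with parameter $n$ up to and including ''print('' and $r$ is '')'', the expression True denotes the boolean True, and leq() denotes True if $n<m$ and False otherwise (with $n<\infty$ for all $n\in\mathbb N$). The only valid context for leq() is inside print($\cdot$); the occurrence of leq() next to def has denotation $\emptyset$. *)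

(* Defs.v *)
(* MathComp world, with classical sets from MathComp-Analysis and Stdlib
   strings for program texts. *)
From Stdlib Require Import Ascii String Decimal DecimalString.
From HB Require Import structures.
From mathcomp Require Import all_boot.
From mathcomp Require Import boolp classical_sets.

Set Implicit Arguments.
Unset Strict Implicit.
Unset Printing Implicit Defensive.

Local Open Scope classical_set_scope.

(** * Languages with a denotation function *)

Notation word A := (seq A).

(* [(l, r)] is the context in which [e] forms the string [l ++ e ++ r]. *)
Definition context (Sigma : Type) : Type := (word Sigma * word Sigma)%type.

Record language (Sigma Y : Type) := Language {
  strings : set (word Sigma);
  den : word Sigma -> context Sigma -> Y }.

(* [null] is the null referent. *)
Definition supp (Sigma Y : Type) (null : Y) (L : language Sigma Y)
    (k : context Sigma) : set (word Sigma) :=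
  [set e | den L e k <> null].

Definition oracle (Sigma : Type) : Type :=
  word Sigma -> word Sigma -> context Sigma -> bool.

Definition aleph (Sigma : Type) (Y : countType) (L : language Sigma Y) :
    oracle Sigma :=
  fun e e' k => den L e k == den L e' k.

(** * Turing machines *)

(* A tape is infinite to the right.  A cell holds an [option G], where [None] is
   the blank; [cells] is a finite prefix of the tape, blank beyond its end.  A
   left move on the leftmost cell leaves the head where it is. *)
Inductive move := MoveLeft | Stay | MoveRight.

Record tape (G : Type) := Tape { cells : seq (option G); head : nat }.

Definition read (G : Type) (t : tape G) : option G :=
  nth None (cells t) (head t).

Definition write_move (G : Type) (t : tape G) (a : option G * move) : tape G :=
  Tape (set_nth None (cells t) (head t) a.1)
       (match a.2 with
        | MoveLeft => (head t).-1 | Stay => head t | MoveRight => (head t).+1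
        end).

Definition tape_of (G : Type) (w : word G) : tape G := Tape (map Some w) 0.

(* The word on a tape extends from the leftmost cell up to the first blank. *)
Fixpoint unblank (G : Type) (s : seq (option G)) : word G :=
  if s is Some a :: s' then a :: unblank s' else [::].

Definition word_of (G : Type) (t : tape G) : word G := unblank (cells t).

(* A tuple of words over [A] as one word over [option A], in which the letter
   [None] is the separator. *)
Fixpoint join (A : Type) (ws : seq (word A)) : word (option A) :=
  match ws with
  | [::] => [::]
  | [:: w] => map Some w
  | w :: ws' => map Some w ++ None :: join ws'
  end.

(** ** Machines without oracle *)

(* Deterministic single-tape machine with input alphabet [A], which is embedded
   in the tape alphabet by [tm_in].  It stops as soon as it is in one of the two
   halting states. *)
Record tm (A : Type) := TM {
  tm_state : finType;
  tm_sym : finType;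
  tm_in : A -> tm_sym;
  tm_in_inj : injective tm_in;
  tm_start : tm_state;
  tm_accept : tm_state;
  tm_reject : tm_state;
  tm_accept_reject : tm_accept != tm_reject;
  tm_trans : tm_state -> option tm_sym -> tm_state * (option tm_sym * move) }.

Section TMRun.
Variables (A : Type) (M : tm A).

Definition tm_config : Type := (tm_state M * tape (tm_sym M))%type.

Definition tm_halted (c : tm_config) : bool :=
  (c.1 == tm_accept M) || (c.1 == tm_reject M).

Definition tm_step (c : tm_config) : tm_config :=
  if tm_halted c then c else
  let: (q, a) := tm_trans c.1 (read c.2) in (q, write_move c.2 a).

Definition tm_run (w : word A) (n : nat) : tm_config :=
  iter n tm_step (tm_start M, tape_of (map (@tm_in _ M) w)).

Definition tm_halts (w : word A) : Prop :=
  exists n, tm_halted (tm_run w n).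

Definition tm_accepts (w : word A) : Prop :=
  exists n, (tm_run w n).1 = tm_accept M.

End TMRun.

(** ** Oracle machines *)

(* Deterministic machine with a work tape, which holds the input at the start
   and the output at the end, and a query tape with alphabet [option A], i.e.
   the letters of [A] and the separator of [join].  A step from [otm_query]
   moves to [otm_yes] or [otm_no] according to the oracle's answer to the query
   written on the query tape, and erases that tape. *)
Record otm (A : Type) := OTM {
  otm_state : finType;
  otm_sym : finType;
  otm_in : A -> otm_sym;
  otm_in_inj : injective otm_in;
  otm_start : otm_state;
  otm_halt : otm_state;
  otm_query : otm_state;
  otm_yes : otm_state;
  otm_no : otm_state;
  otm_query_halt : otm_query != otm_halt;
  otm_trans : otm_state -> option otm_sym -> option (option A) ->
    otm_state * (option otm_sym * move) * (option (option A) * move) }.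

Section OTMRun.
Variables (A : Type) (M : otm A) (O : oracle A).

Definition otm_config : Type :=
  (otm_state M * tape (otm_sym M) * tape (option A))%type.

(* A word that does not encode a query is answered by [false]. *)
Definition answer (w : word (option A)) : bool :=
  `[< exists e e' l r, w = join [:: e; e'; l; r] /\ O e e' (l, r) >].

Definition otm_step (c : otm_config) : otm_config :=
  let: (q, t, u) := c in
  if q == otm_halt M then c else
  if q == otm_query M then
    (if answer (word_of u) then otm_yes M else otm_no M, t, tape_of [::])
  else
    let: (q', a, b) := otm_trans q (read t) (read u) in
    (q', write_move t a, write_move u b).

Definition otm_run (w : word A) (n : nat) : otm_config :=
  iter n otm_step (otm_start M, tape_of (map (@otm_in _ M) w), tape_of [::]).

(* On input [w], the machine halts with output [v], a word over its own tape
   alphabet. *)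
Definition otm_outputs (w : word A) (v : word (otm_sym M)) : Prop :=
  exists n, let: (q, t, _) := otm_run w n in q = otm_halt M /\ word_of t = v.

End OTMRun.

(** * Emulation *)

(* The input of [delta]: its alphabet consists of the output alphabet of the
   oracle machine, the alphabet of the language and a separator. *)
Definition delta_input (G Sigma : Type) (u v : word G) (k : context Sigma) :
    word (option (G + Sigma)) :=
  join [:: map inl u; map inl v; map inr k.1; map inr k.2].

Definition aleph_emulatable (Sigma : Type) (Y : countType) (null : Y)
    (C : set (language Sigma Y)) : Prop :=
  exists (mu : otm Sigma) (delta : tm (option (otm_sym mu + Sigma))),
    forall L, C L -> forall (k : context Sigma) (e e' : word Sigma),
      supp null L k e -> supp null L k e' ->
      exists u v : word (otm_sym mu),
        [/\ otm_outputs (aleph L) e u,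
            otm_outputs (aleph L) e' v,
            tm_halts delta (delta_input u v k) &
            den L e k = den L e' k <-> tm_accepts delta (delta_input u v k)].

(** * The Python fragment *)

(* [None] is infinity. *)
Definition natinf : Type := option nat.

Definition natinf_lt (x y : natinf) : bool :=
  match x, y with
  | Some a, Some b => a < b
  | Some _, None => true
  | None, _ => false
  end.

Inductive pyexpr :=
| EInt of nat
| ETrue
| EName of string
| ELt of pyexpr & pyexpr
| ECall0 of pyexpr
| ECall1 of pyexpr & pyexpr.

(* The program
     def leq() -> [ret_ann]:
         return [ret_expr]
     [last_stmt] *)
Record pyprog := PyProg {
  ret_ann : pyexpr;
  ret_expr : pyexpr;
  last_stmt : pyexpr }.

(** ** Concrete syntax *)

Definition newline : string := String "010"%char EmptyString.

Definition numeral (n : nat) : string :=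
  NilZero.string_of_uint (Nat.to_uint n).

(* No parentheses are ever needed in the programs below. *)
Fixpoint expr_text (a : pyexpr) : string :=
  match a with
  | EInt n => numeral n
  | ETrue => "True"
  | EName x => x
  | ELt a b => expr_text a ++ " < " ++ expr_text b
  | ECall0 f => expr_text f ++ "()"
  | ECall1 f a => expr_text f ++ "(" ++ expr_text a ++ ")"
  end%string.

Definition text_def : string := "def leq() -> "%string.
Definition text_return : string := (":" ++ newline ++ "    return ")%string.

Definition prog_text (p : pyprog) : string :=
  (text_def ++ expr_text (ret_ann p) ++ text_return ++ expr_text (ret_expr p)
   ++ newline ++ expr_text (last_stmt p))%string.

(* [expr_occ a l b r]: [b] is a node of the syntax tree of [a], and the text of
   [a] is [l], the text of [b], and [r]. *)
Inductive expr_occ : pyexpr -> string -> pyexpr -> string -> Prop :=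
| occ_root a : expr_occ a "" a ""
| occ_lt_l a b l c r : expr_occ a l c r ->
    expr_occ (ELt a b) l c (r ++ " < " ++ expr_text b)
| occ_lt_r a b l c r : expr_occ b l c r ->
    expr_occ (ELt a b) (expr_text a ++ " < " ++ l) c r
| occ_call0 f l c r : expr_occ f l c r ->
    expr_occ (ECall0 f) l c (r ++ "()")
| occ_call1_fun f a l c r : expr_occ f l c r ->
    expr_occ (ECall1 f a) l c (r ++ "(" ++ expr_text a ++ ")")
| occ_call1_arg f a l c r : expr_occ a l c r ->
    expr_occ (ECall1 f a) (expr_text f ++ "(" ++ l) c (r ++ ")").

(* The expressions of a program.  The name [leq] that follows [def] is not one
   of them. *)
Inductive prog_occ (p : pyprog) : string -> pyexpr -> string -> Prop :=
| occ_ann l c r : expr_occ (ret_ann p) l c r ->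
    prog_occ p (text_def ++ l) c
      (r ++ text_return ++ expr_text (ret_expr p) ++ newline
         ++ expr_text (last_stmt p))
| occ_ret l c r : expr_occ (ret_expr p) l c r ->
    prog_occ p (text_def ++ expr_text (ret_ann p) ++ text_return ++ l) c
      (r ++ newline ++ expr_text (last_stmt p))
| occ_last l c r : expr_occ (last_stmt p) l c r ->
    prog_occ p (text_def ++ expr_text (ret_ann p) ++ text_return
                  ++ expr_text (ret_expr p) ++ newline ++ l) c r.

(** ** Evaluation *)

Inductive pyval :=
| VNum of natinf
| VBool of bool
| VNone
| VBoolType           (* the built-in type [bool] *)
| VPrint              (* the built-in function [print] *)
| VFun of pyexpr.     (* a function without parameters, by its returned expression *)

(* Big-step evaluation when [M] is [m] and [leq] returns [body]. *)
Inductive evals (m : natinf) (body : pyexpr) : pyexpr -> pyval -> Prop :=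
| ev_int n : evals m body (EInt n) (VNum (Some n))
| ev_true : evals m body ETrue (VBool true)
| ev_M : evals m body (EName "M") (VNum m)
| ev_bool : evals m body (EName "bool") VBoolType
| ev_print : evals m body (EName "print") VPrint
| ev_leq : evals m body (EName "leq") (VFun body)
| ev_lt a b x y : evals m body a (VNum x) -> evals m body b (VNum y) ->
    evals m body (ELt a b) (VBool (natinf_lt x y))
| ev_call0 f c v : evals m body f (VFun c) -> evals m body c v ->
    evals m body (ECall0 f) v
| ev_call_print f a v : evals m body f VPrint -> evals m body a v ->
    evals m body (ECall1 f a) VNone.

(** * The class Leq *)

Definition template1 (n : nat) : pyprog :=
  PyProg (EName "bool") (ELt (EInt n) (EName "M"))
         (ECall1 (EName "print") (ECall0 (EName "leq"))).

Definition template2 (n : nat) : pyprog :=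
  PyProg (EName "bool") (ELt (EInt n) (EName "M"))
         (ECall1 (EName "print") ETrue).

Definition leq_prog (p : pyprog) : Prop :=
  exists n, p = template1 n \/ p = template2 n.

(* The characters used in Python programs: newline and printable ASCII. *)
Definition pychar (c : ascii) : bool :=
  let n := nat_of_ascii c in (n == 10) || (32 <= n <= 126).

Section Leq.
(* [chr] embeds the Python characters in the alphabet, and [ref] the Python
   values in the set of referents. *)
Variables (Sigma : Type) (chr : ascii -> Sigma).
Variables (Y : countType) (null : Y) (ref : pyval -> Y).

Definition encode (s : string) : word Sigma := map chr (list_ascii_of_string s).

Definition leq_strings : set (word Sigma) :=
  [set w | exists2 p, leq_prog p & w = encode (prog_text p)].

(* [v] is the value of an occurrence of the expression [e] in the context [k]. *)
Definition leq_value (m : natinf) (e : word Sigma) (k : context Sigma)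
    (v : pyval) : Prop :=
  exists p l a r, [/\ leq_prog p, prog_occ p l a r,
    e = encode (expr_text a), k = (encode l, encode r) &
    evals m (ret_expr p) a v].

(* [e] and [k] determine [v], so that [xget] selects its only candidate, or
   [null] when there is none. *)
Definition leq_den (m : natinf) (e : word Sigma) (k : context Sigma) : Y :=
  xget null [set ref v | v in leq_value m e k].

Definition leq_language (m : natinf) : language Sigma Y :=
  Language leq_strings (leq_den m).

Definition Leq : set (language Sigma Y) := range leq_language.

End Leq.

(* Main.v *)
(* Whatever [mu] has read off the oracle of [L_oo] after finitely many steps
   already holds in [L_m] for all large [m]: each single query has the same
   answer in all languages [L_m] with [m] large, infinity included.  So for
   large [m] the machine [mu] represents "leq()" and "True" by the same words
   in [L_m] as in [L_oo], and [delta] gives the same verdict on them in every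
   context.  But in the context "print( )" of the program with parameter
   [n = m] the two expressions are equal in [L_oo] and differ in [L_m]. *)
Require Import Defs.
From Stdlib Require Import Ascii String Decimal DecimalString DecimalNat.
From mathcomp Require Import all_boot.
From mathcomp Require Import boolp classical_sets zify.

Set Implicit Arguments.
Unset Strict Implicit.
Unset Printing Implicit Defensive.

Notation chars := list_ascii_of_string.

(** The first letter that fails [P] fixes the cut. This serves for the separators of [join] and for
    the space after a numeral. *)
Lemma cat_cons_inj (T : Type) (P : pred T) x (s s' t t' : seq T) :
  ~~ P x -> all P s -> all P s' -> s ++ x :: t = s' ++ x :: t' ->
  s = s' /\ t = t'.
Proof.
move=> Px; elim: s s' => [|y s IH] [|y' s'] //=.
- by move=> _ _ [].
- by move=> _ /andP[Py' _] [yE _]; rewrite yE Py' in Px.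
- by move=> /andP[Py _] _ [yE _]; rewrite -yE Py in Px.
move=> /andP[_ Ps] /andP[_ Ps'] [<- eq_st].
by have [-> ->] := IH s' Ps Ps' eq_st.
Qed.

(** * Oracle machines *)

Lemma join4_inj (A : Type) (a b c d a' b' c' d' : word A) :
  join [:: a; b; c; d] = join [:: a'; b'; c'; d'] ->
  [/\ a = a', b = b', c = c' & d = d'].
Proof.
have Sinj : injective (map (@Some A)) by apply: inj_map => x y [].
have allS (w : word A) : all isSome (map Some w) by elim: w.
have split := @cat_cons_inj (option A) isSome None _ _ _ _ isT (allS _) (allS _).
by move=> /= /split[/Sinj-> /split[/Sinj-> /split[/Sinj-> /Sinj->]]].
Qed.

Lemma answer_join (A : Type) (O : oracle A) e e' l r :
  answer O (join [:: e; e'; l; r]) = O e e' (l, r).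
Proof.
rewrite /answer; apply/asboolP/idP => [[f [f' [l' [r' [eqw Ow]]]]]|Ow].
  by have [-> -> -> ->] := join4_inj eqw.
by exists e, e', l, r.
Qed.

(** Malformed words get the same answer from every oracle, so only genuine queries have to be
    compared. *)
Lemma answerP (A : Type) (w : word (option A)) :
  (exists e e' l r, w = join [:: e; e'; l; r])
  \/ (forall O : oracle A, answer O w = false).
Proof.
have [wE|wN] := pselect (exists e e' l r, w = join [:: e; e'; l; r]).
  by left.
right=> O; apply/asboolP => -[e [e' [l [r [wE _]]]]].
by apply: wN; exists e, e', l, r.
Qed.

Lemma otm_runS (A : Type) (M : otm A) (O : oracle A) w n :
  otm_run M O w n.+1 = otm_step O (otm_run M O w n).
Proof. by []. Qed.

(** A halted configuration never changes, so the later of two halting times shows the same tape as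
    the earlier one. *)
Lemma otm_outputs_inj (A : Type) (M : otm A) (O : oracle A) w u v :
  @otm_outputs A M O w u -> @otm_outputs A M O w v -> u = v.
Proof.
have stable n k : (otm_run M O w n).1.1 = otm_halt M ->
    otm_run M O w (k + n) = otm_run M O w n.
  move=> haltn; elim: k => // k IH.
  rewrite addSn otm_runS IH.
  by case: (otm_run M O w n) haltn => -[q t] x /= ->; rewrite /otm_step eqxx.
suff H : forall u' v' n k,
    (let: (q, t, _) := otm_run M O w n in q = otm_halt M /\ word_of t = u') ->
    (let: (q, t, _) := otm_run M O w (k + n) in
       q = otm_halt M /\ word_of t = v') -> u' = v'.
  move=> [n Hn] [n' Hn']; case: (leqP n n') => [le|/ltnW le].
    by apply: (H u v n (n' - n)); rewrite ?subnK.
  by apply/esym/(H v u n' (n - n')); rewrite ?subnK.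
move=> {}u {}v n k Hn; rewrite stable; last first.
  by case: (otm_run M O w n) Hn => -[q t] ? [].
by case: (otm_run M O w n) Hn => -[q t] ? [_ <-] [_ <-].
Qed.

(** A run of [t] steps poses at most [t] queries, so the maximum of finitely many thresholds works
    although the hypothesis is only pointwise. *)
Lemma otm_run_eventually (A : Type) (M : otm A) (O : nat -> oracle A)
    (Oinf : oracle A) (w : word A) (t : nat) :
  (forall e e' k, exists N, forall m, N <= m -> O m e e' k = Oinf e e' k) ->
  exists N, forall m, N <= m -> otm_run M (O m) w t = otm_run M Oinf w t.
Proof.
move=> Ostable; elim: t => [|t [N IH]]; first by exists 0.
have [N' ansN'] : exists N', forall m, N' <= m ->
    answer (O m) (word_of (otm_run M Oinf w t).2)
    = answer Oinf (word_of (otm_run M Oinf w t).2).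
  have [[e [e' [l [r ->]]]]|noq] := answerP (word_of (otm_run M Oinf w t).2).
    have [N' HN'] := Ostable e e' (l, r).
    by exists N' => m /HN'; rewrite !answer_join.
  by exists 0 => m _; rewrite !noq.
exists (maxn N N') => m; rewrite geq_max => /andP[leN leN'].
rewrite !otm_runS (IH m leN).
move: (ansN' m leN'); case: (otm_run M Oinf w t) => -[q x] y /= ansE.
by rewrite ansE.
Qed.

(** * Unique readability *)

Lemma size_chars_cat (s t : string) :
  size (chars (s ++ t)) = size (chars s) + size (chars t).
Proof. by elim: s => //= c s ->. Qed.

Lemma chars_cat (s t : string) : chars (s ++ t) = chars s ++ chars t.
Proof. by elim: s => //= c s ->. Qed.

Lemma chars_inj : injective chars.
Proof. by move=> s t E; rewrite -[s]string_of_list_ascii_of_string E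
  string_of_list_ascii_of_string. Qed.

Lemma expr_occ_text a l c r :
  expr_occ a l c r ->
  chars (expr_text a) = chars l ++ chars (expr_text c) ++ chars r.
Proof.
by elim=> {a l c r} /= [a|a b l c r _ IH|a b l c r _ IH|f l c r _ IH
    |f a l c r _ IH|f a l c r _ IH]; rewrite ?cats0 // ?chars_cat /= ?chars_cat
  IH -?catA /= -?catA.
Qed.

(** Each composite node adds characters around or between its children, so distinct nodes differ in
    the length of text to their left or right. *)
Lemma expr_occ_inj a l c r l' c' r' :
  expr_occ a l c r -> expr_occ a l' c' r' ->
  size (chars l) = size (chars l') -> size (chars r) = size (chars r') ->
  c = c'.
Proof.
move=> occ; elim: occ l' c' r' => {a l c r}
  [a|a b l c r occ IH|a b l c r occ IH|f l c r occ IH|f a l c r occ IH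
    |f a l c r occ IH] l' c' r' occ'; inversion occ'; subst => //=;
  rewrite ?size_chars_cat /= ?size_chars_cat /=;
  try (by intros; lia);
  try (by intros; eapply IH; [eassumption|lia|lia]);
  repeat match goal with H : expr_occ _ _ _ _ |- _ =>
    move: (congr1 size (expr_occ_text H)); rewrite !size_cat; clear H end;
  by intros; lia.
Qed.

Lemma prog_occ_text p l c r :
  prog_occ p l c r ->
  chars (prog_text p) = chars l ++ chars (expr_text c) ++ chars r.
Proof.
by case=> {}l {}c {}r /expr_occ_text E;
  rewrite /prog_text !chars_cat E -!catA.
Qed.

Lemma prog_occ_inj p l c r l' c' r' :
  prog_occ p l c r -> prog_occ p l' c' r' ->
  size (chars l) = size (chars l') -> size (chars r) = size (chars r') ->
  c = c'.
Proof.
move=> [] {}l {}c {}r occ [] {}l' {}c' {}r' occ';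
  rewrite ?size_chars_cat /= ?size_chars_cat /=;
  try (by intros; eapply expr_occ_inj; [exact: occ|exact: occ'|lia|lia]);
  move: (congr1 size (expr_occ_text occ)) (congr1 size (expr_occ_text occ'));
  by rewrite !size_cat; intros; lia.
Qed.

Lemma evals_inj m body a v v' :
  evals m body a v -> evals m body a v' -> v = v'.
Proof.
move=> ev; elim: ev v' => {a v} [n||||||a b x y _ IHa _ IHb|f c v _ IHf _ IHc
  |f a v _ _ _ _] w ev; inversion ev; subst => //.
- by have [->] := IHa _ H1; have [->] := IHb _ H3.
- by have [cE] := IHf _ H0; subst; apply: IHc.
Qed.

(** * Decimal numerals and the texts of the two templates *)

Definition digit (c : ascii) : bool := 48 <= nat_of_ascii c <= 57.

Lemma numeral_digits n : all digit (chars (numeral n)).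
Proof.
have digits d : all digit (chars (NilEmpty.string_of_uint d)) by elim: d.
by rewrite /numeral; case: (Nat.to_uint n) => // d; apply: (digits _).
Qed.

Lemma numeral_inj : injective numeral.
Proof.
(* [NilZero] prints the empty digit list as it prints zero, so the round trip needs a nonempty
   list. *)
have to_uint_nz n : Nat.to_uint n <> Decimal.Nil.
  by move=> E; have := Unsigned.of_to n; rewrite E => n0; rewrite -n0 in E.
move=> n n' E; apply: Unsigned.to_uint_inj.
have := NilZero.usu _ (@to_uint_nz n); rewrite -/(numeral n) E.
by rewrite (NilZero.usu _ (@to_uint_nz n')) => -[].
Qed.

(** After the common prefix, the first space ends the numeral and so yields [n]; the last lines tell
    the templates apart. *)
Lemma leq_prog_text_inj p p' :
  leq_prog p -> leq_prog p' -> prog_text p = prog_text p' -> p = p'.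
Proof.
have space : ~~ digit " "%char by [].
by move=> [n [] ->] [n' [] ->] /(congr1 chars) [];
  rewrite !chars_cat -!catA /= => /(cat_cons_inj space (numeral_digits _)
    (numeral_digits _))[/chars_inj/numeral_inj->].
Qed.

Lemma leq_prog_pychar p : leq_prog p -> all pychar (chars (prog_text p)).
Proof.
have digitS s : all digit s -> all pychar s.
  by apply: sub_all => c; rewrite /digit /pychar; lia.
by move=> [n [] ->]; rewrite /prog_text /= !chars_cat /=
  ?all_cat ?(digitS _ (numeral_digits n)).
Qed.

(** * Denotations in the languages [L_m] *)

#[local] Hint Constructors evals : core.

(** Once [n < m], the comparison is true whatever [m] is, and the only number among the nodes other
    than [M] is [n], which differs from [m]. *)
Lemma leq_node_evals p l a r :
  leq_prog p -> prog_occ p l a r ->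
  a = EName "M" \/
  exists n v, forall m, natinf_lt (Some n) m ->
    evals m (ret_expr p) a v /\ v <> VNum m.
Proof.
move=> [n Pp] occ.
have [|neqM] := pselect (a = EName "M"); first by left.
right; exists n.
have evlt m : natinf_lt (Some n) m ->
    evals m (ret_expr (template1 n)) (ELt (EInt n) (EName "M")) (VBool true).
  (* Rewriting [true] would also hit the bits of the characters of "M". *)
  move=> lt_nm; suff: VBool (natinf_lt (Some n) m) = VBool true.
    by move=> <-; exact: ev_lt (ev_int _ _ _) (ev_M _ _).
  by rewrite lt_nm.
case: Pp occ => -> occ; inversion occ; clear occ; subst;
  repeat match goal with H : expr_occ _ _ _ _ |- _ =>
    inversion H; clear H; subst end; try by case: neqM.
all: cbn [template1 template2 ret_ann ret_expr last_stmt] in *.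
(* The value is fixed before [m], so it cannot depend on [m]; [evlt] settles the comparison. *)
all: eexists => m lt_nm; split; first by eauto.
all: try by [].
all: by case=> mE; rewrite -mE /= ltnn in lt_nm.
Qed.

Section LeqLanguages.
Variables (Sigma : Type) (chr : ascii -> Sigma).
Hypothesis chr_inj :
  forall a b : ascii, pychar a -> pychar b -> chr a = chr b -> a = b.
Variables (Y : countType) (null : Y) (ref : pyval -> Y).

Lemma encode_inj s t :
  all pychar (chars s) -> all pychar (chars t) ->
  encode chr s = encode chr t -> s = t.
Proof.
rewrite /encode => Ps Pt E; apply: chars_inj; move: Ps Pt E.
elim: (chars s) (chars t) => [|x {}s IH] [|y {}t] //=.
by move=> /andP[Px Ps] /andP[Py Pt] [/(chr_inj Px Py)-> /(IH _ Ps Pt)->].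
Qed.

(** Expression and context spell the program, the lengths of the context locate the node, and
    evaluation is deterministic: [xget] chooses from a singleton. *)
Lemma leq_valueE m l p a r v :
  leq_prog p -> prog_occ p l a r -> evals m (ret_expr p) a v ->
  leq_den chr null ref m (encode chr (expr_text a)) (encode chr l, encode chr r)
  = ref v.
Proof.
move=> Pp occ ev; apply: xget_unique.
  by exists v => //; exists p, l, a, r.
move=> _ [v' [p' [l' [a' [r' [Pp' occ' aE [lE rE] ev']]]]] <-].
have pE : p = p'.
  apply: leq_prog_text_inj => //.
  apply: encode_inj; rewrite ?leq_prog_pychar //.
  rewrite /encode (prog_occ_text occ) (prog_occ_text occ') !map_cat.
  by rewrite -!/(encode _ _) aE lE rE.
rewrite -{p'}pE in Pp' occ' ev'.
have sizeE s : size (chars s) = size (encode chr s) by rewrite size_map.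
have a_a' : a = a' by apply: (prog_occ_inj occ occ'); rewrite !sizeE ?lE ?rE.
by rewrite -a_a' in ev'; rewrite (evals_inj ev ev').
Qed.

Hypotheses (ref_inj : injective ref) (ref_null : forall v, ref v <> null).

(* The first case is that of the expression [M]; any other expression depends
   on [m] only through [n < m], with [n] fixed by the expression and context. *)
Lemma leq_den_eventually e k :
  (forall m, leq_den chr null ref m e k = ref (VNum m)) \/
  exists n y, forall m, natinf_lt (Some n) m ->
    leq_den chr null ref m e k = y /\ y <> ref (VNum m).
Proof.
have [[p [l [a [r [Pp occ -> ->]]]]]|noocc] := pselect (exists p l a r,
    [/\ leq_prog p, prog_occ p l a r, e = encode chr (expr_text a)
      & k = (encode chr l, encode chr r)]).
  have [aM|[n [v ev]]] := leq_node_evals Pp occ.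
    left=> m; apply: (leq_valueE Pp occ); rewrite aM; exact: ev_M.
  right; exists n, (ref v) => m /ev[evm vm].
  by split; [exact: (leq_valueE Pp occ) | move=> /ref_inj].
right; exists 0, null => m _; split; last by move/esym/ref_null.
apply: xgetPN => y [v [p [l [a [r [Pp occ eE kE _]]]]] _].
by apply: noocc; exists p, l, a, r.
Qed.

(** Stable denotations compare alike past their thresholds, and a stable one never equals the value
    of [M] there. Infinity lies above every threshold. *)
Lemma aleph_leq_eventually e e' k :
  exists N, forall m, N <= m ->
    aleph (leq_language chr null ref (Some m)) e e' k
    = aleph (leq_language chr null ref None) e e' k.
Proof.
have [denM|[n [y den]]] := leq_den_eventually e k;
  have [denM'|[n' [y' den']]] := leq_den_eventually e' k; rewrite /aleph /=.
- by exists 0 => m _; rewrite !denM !denM' !eqxx.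
- exists n'.+1 => m lt_m.
  have [-> neq] := den' (Some m) lt_m; have [-> neq'] := den' None isT.
  by rewrite !denM; apply/eqP/eqP => /esym.
- exists n.+1 => m lt_m.
  have [-> neq] := den (Some m) lt_m; have [-> neq'] := den None isT.
  by rewrite !denM'; apply/eqP/eqP.
exists (maxn n n').+1 => m; rewrite gtn_max => /andP[lt_m lt_m'].
have [-> _] := den (Some m) lt_m; have [-> _] := den' (Some m) lt_m'.
by have [-> _] := den None isT; have [-> _] := den' None isT.
Qed.

(** The hole of [print( )], common to both templates: [template1 n] has the call there,
    [template2 n] has [True]. *)
Definition leq_ctx n : context Sigma :=
  (encode chr (text_def ++ expr_text (EName "bool") ++ text_return
     ++ expr_text (ELt (EInt n) (EName "M")) ++ newline ++ "print("),
   encode chr ")").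

Lemma leq_den_call m n :
  leq_den chr null ref m (encode chr "leq()") (leq_ctx n)
  = ref (VBool (natinf_lt (Some n) m)).
Proof.
apply: (@leq_valueE _ _ (template1 n) (ECall0 (EName "leq"))).
- by exists n; left.
- by apply: occ_last; apply: (occ_call1_arg _ (occ_root _)).
apply: ev_call0; first exact: ev_leq.
by apply: ev_lt; [exact: ev_int | exact: ev_M].
Qed.

Lemma leq_den_true m n :
  leq_den chr null ref m (encode chr "True") (leq_ctx n) = ref (VBool true).
Proof.
apply: (@leq_valueE _ _ (template2 n) ETrue).
- by exists n; right.
- by apply: occ_last; apply: (occ_call1_arg _ (occ_root _)).
exact: ev_true.
Qed.

End LeqLanguages.

Theorem theorem2 (Sigma : finType) (chr : ascii -> Sigma)
    (chr_inj : forall a b : ascii, pychar a -> pychar b -> chr a = chr b -> a = b)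
    (Y : countType) (null : Y) (ref : pyval -> Y)
    (ref_inj : injective ref) (ref_null : forall v : pyval, ref v <> null) :
  ~ aleph_emulatable null (Leq chr null ref).
Proof.
move=> [mu [delta emu]].
pose L m := leq_language chr null ref m.
pose e := encode chr "leq()"; pose e' := encode chr "True".
have emuL m n := emu (L m) (ex_intro2 _ _ m I erefl) (leq_ctx chr n) e e'.
have supp_e m n : supp null (L m) (leq_ctx chr n) e.
  by rewrite /supp /= leq_den_call.
have supp_e' m n : supp null (L m) (leq_ctx chr n) e'.
  by rewrite /supp /= leq_den_true.
have outputs_eventually w u : otm_outputs (M := mu) (aleph (L None)) w u ->
    exists N, forall m, N <= m -> otm_outputs (M := mu) (aleph (L (Some m))) w u.
  move=> [t out]; have [N stable] := @otm_run_eventually _ mu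
    (fun m => aleph (L (Some m))) _ w t
    (aleph_leq_eventually chr_inj ref_inj ref_null).
  by exists N => m leNm; exists t; rewrite (stable m leNm).
(* The parameter 0 is arbitrary: [mu] does not see the context. *)
have [u [v [out_u out_v _ _]]] := emuL None 0 (supp_e _ _) (supp_e' _ _).
have [N outN] := outputs_eventually _ _ out_u.
have [N' outN'] := outputs_eventually _ _ out_v.
(* Past both thresholds, [m] also becomes the program parameter: [m < m] fails in [L (Some m)],
   while [m] is below infinity. *)
pose m := maxn N N'.
have [u1 [v1 [out_u1 out_v1 _ acc1]]] := emuL None m (supp_e _ _) (supp_e' _ _).
have [u2 [v2 [out_u2 out_v2 _ acc2]]] :=
  emuL (Some m) m (supp_e _ _) (supp_e' _ _).
(* Outputs are unique, so both equivalences concern [delta] on the same input. *)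
rewrite (otm_outputs_inj out_u1 out_u) (otm_outputs_inj out_v1 out_v) in acc1.
rewrite (otm_outputs_inj out_u2 (outN m (leq_maxl _ _)))
  (otm_outputs_inj out_v2 (outN' m (leq_maxr _ _))) in acc2.
(* Equality in [L None] makes [delta] accept, which forces equality in [L (Some m)], that is, false
   equal to true. *)
have /acc1/acc2 : den (L None) e (leq_ctx chr m) = den (L None) e' (leq_ctx chr m).
  by rewrite /= leq_den_call ?leq_den_true.
by rewrite /= leq_den_call // leq_den_true // /= ltnn => /ref_inj.
Qed.
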